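(* Let $\mathcal{A}$ be an allotment of an LBDD instance. Then $\mathcal{A}$ is an optimal allotment if and only if $\mathcal{A}$ does not induce any negative cost loop.
   Context: An instance of the Load Balanced Demand Distribution (LBDD) problem consists of: a finite set $S=\{s_1,\dots,s_k\}$ of service centers ($k\ge 2$); a finite set $D$ of $n$ demand units; a cost matrix $\mathcal{CM}$ giving a positive integer $\mathcal{CM}(d,s)$ for every pair $(d,s)\in D\times S$; for each $s_i$ a positive integer capacity $c_i$; and for each $s_i$ a penalty function $q_i$ on the positive integers, where $q_i(m)$ is the extra cost incurred by the $m$-th demand unit assigned to $s_i$: $q_i(m)=0$ for $m\le c_i$, and for $m>c_i$ the values $q_i(m)$ are positive and monotonically increasing in $m$ (convention $q_i(0)=0$). An allotment $\mathcal{A}$ assigns every demand unit to exactly one service center. The occupancy $o_i=o_i(\mathcal{A})$ is the number of demand units assigned to $s_i$. The cost of $\mathcal{A}$ is $\sum_{d\in D}\mathcal{CM}(d,\mathcal{A}(d))+\sum_{i=1}^{k}\sum_{m=1}^{o_i}q_i(m)$; $\mathcal{A}$ is optimal if it has minimum cost among all allotments. The allotment subspace multigraph $\Gamma(\mathcal{A})$ has vertex set $S$ and, for each demand unit $dn$ assigned to $s_i$ and each $s_j\neq s_i$, a directed transfer edge $(s_i,s_j,dn)$ of cost $\mathcal{CM}(dn,s_j)-\mathcal{CM}(dn,s_i)$. The penalty transfer edge from $s_x$ to $s_y$ ($x\ne y$) has weight $q_x(o_x+1)-q_y(o_y)$. A loop induced by $\mathcal{A}$ from $s_i$ to $s_j$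 ($s_i\neq s_j$) consists of a directed path $P$ in $\Gamma(\mathcal{A})$ from $s_i$ to $s_j$ with pairwise distinct vertices, closed either (i) by a transfer edge of $\Gamma(\mathcal{A})$ from $s_j$ to $s_i$, the loop's cost being the sum of the costs of all its transfer edges; or (ii) by the penalty transfer edge from $s_j$ to $s_i$, the loop's cost being the sum of the costs of the edges of $P$ plus $q_j(o_j+1)-q_i(o_i)$. A loop is negative (a negative cost loop) if its cost is less than zero. *)

(* Defs.v *)
From HB Require Import structures.
From mathcomp Require Import all_boot all_order all_algebra.

Set Implicit Arguments.
Unset Strict Implicit.
Unset Printing Implicit Defensive.

Import Order.TTheory GRing.Theory Num.Theory.
Local Open Scope ring_scope.

(* D: demand units, S: service centers.  Assignment costs are positive integers;
   penalties take values in any ordered integral domain R, which covers integer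
   as well as real penalties. *)
Record lbdd (R : realDomainType) (D S : finType) := LBDD {
  CM : D -> S -> nat;
  capacity : S -> nat;
  penalty : S -> nat -> R;
  centers_gt1 : (1 < #|S|)%N;
  CM_gt0 : forall d s, (0 < CM d s)%N;
  capacity_gt0 : forall s, (0 < capacity s)%N;
  (* m = 0 is included: this is the convention q(0) = 0. *)
  penalty_eq0 : forall s m, (m <= capacity s)%N -> penalty s m = 0;
  penalty_gt0 : forall s m, (capacity s < m)%N -> 0 < penalty s m;
  (* "Increasing" in the wide sense; strictly increasing penalties are a
     special case. *)
  penalty_homo : forall s m1 m2,
    (capacity s < m1)%N -> (m1 <= m2)%N -> penalty s m1 <= penalty s m2
}.

Section LBDD.

Variables (R : realDomainType) (D S : finType) (I : lbdd R D S).

Definition allotment : Type := {ffun D -> S}.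

Implicit Types (A : allotment) (x y s : S).

Definition occupancy A s : nat := #|[set d | A d == s]|.

Definition allotment_cost A : R :=
  \sum_(d : D) (CM I d (A d))%:R
  + \sum_(s : S) \sum_(1 <= m < (occupancy A s).+1) penalty I s m.

Definition optimal A : Prop :=
  forall B : allotment, allotment_cost A <= allotment_cost B.

(* A candidate edge (source, target, demand unit) of the allotment subspace
   multigraph; the actual edges are those satisfying [transfer_edge]. *)
Definition edge : Type := (S * S * D)%type.

Definition source (e : edge) : S := e.1.1.
Definition target (e : edge) : S := e.1.2.
Definition moved (e : edge) : D := e.2.

Definition transfer_edge A (e : edge) : bool :=
  (A (moved e) == source e) && (target e != source e).

Definition transfer_cost (e : edge) : R :=
  (CM I (moved e) (target e))%:R - (CM I (moved e) (source e))%:R.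

Definition penalty_edge_cost A x y : R :=
  penalty I x (occupancy A x).+1 - penalty I y (occupancy A y).

Fixpoint walk A x (p : seq edge) y : bool :=
  if p is e :: p' then
    [&& transfer_edge A e, source e == x & walk A (target e) p' y]
  else x == y.

Definition simple_path A x (p : seq edge) y : bool :=
  walk A x p y && uniq (x :: map target p).

Definition path_cost (p : seq edge) : R := \sum_(e <- p) transfer_cost e.

(* [induced_loop A x y c]: A induces a loop of cost c from x to y. *)
Inductive induced_loop A x y : R -> Prop :=
| TransferLoop (p : seq edge) (e : edge) of
    x != y & simple_path A x p y
    & transfer_edge A e & source e = y & target e = x :
    induced_loop A x y (path_cost p + transfer_cost e)
| PenaltyLoop (p : seq edge) of x != y & simple_path A x p y :
    induced_loop A x y (path_cost p + penalty_edge_cost A y x).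

Definition induces_negative_loop A : Prop :=
  exists x y c, induced_loop A x y c /\ c < 0.

End LBDD.

(* Main.v *)
Require Import Defs.
From mathcomp Require Import all_boot all_order all_algebra.

(** Moving the demand units of a walk from [x] to [y] changes the transfer part
    of the cost by the cost of the walk and the occupancies only at [x] and [y],
    so performing a negative loop improves the allotment.  Conversely, compare
    [A] with any [B] by induction on the number of units they place differently.
    Those units form a multigraph with an edge from [A d] to [B d].  A longest
    simple path in it either closes to a cycle, or starts at a center without
    incoming edge (less occupied in [B]) and ends at one without outgoing edge
    (more occupied in [B]).  Undoing in [B] the moves of this cycle or path does
    not increase the cost: in the second case penalties are monotone, so the
    gain is at least the cost of a penalty loop of [A]. *)

Set Implicit Arguments.
Unset Strict Implicit.
Unset Printing Implicit Defensive.

Import Order.TTheory GRing.Theory Num.Theory.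
Local Open Scope ring_scope.

Local Notation sources := (map (@source _ _)).
Local Notation targets := (map (@target _ _)).
Local Notation units := (map (@moved _ _)).

(** * Walks in the allotment multigraph *)

Section Walks.

Variables (D S : finType).
Implicit Types (A B : allotment D S) (x y z s : S) (p q : seq (edge D S)).

Lemma walk_cat A x p q y :
  walk A x (p ++ q) y <-> exists2 z, walk A x p z & walk A z q y.
Proof.
elim: p x => [|e p IH] x /=.
  by split=> [w|[z /eqP-> //]]; exists x.
split=> [/and3P[te se /IH[z wp wq]]|[z /and3P[te se wp] wq]].
  by exists z => //; apply/and3P.
by apply/and3P; split=> //; apply/IH; exists z.
Qed.

Lemma walk_split A x p y z :
  walk A x p y -> z \in x :: targets p ->
  exists p1 p2, [/\ p = p1 ++ p2, walk A x p1 z & walk A z p2 y].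
Proof.
elim: p x => [|e p IH] x w.
  by rewrite inE => /eqP->; exists [::], [::]; split=> //=.
rewrite inE => /predU1P[->|zp]; first by exists [::], (e :: p); split=> //=.
case/and3P: w => te se w; have [p1 [p2 [-> w1 w2]]] := IH _ w zp.
by exists (e :: p1), p2; split=> //; apply/and3P.
Qed.

Lemma walk_vertices A x p y :
  walk A x p y -> rcons (sources p) y = x :: targets p.
Proof.
elim: p x => [|e p IH] x /=; first by move/eqP->.
by case/and3P=> _ /eqP-> /IH->.
Qed.

Lemma walk_transfer A x p y : walk A x p y -> all (transfer_edge A) p.
Proof. by elim: p x => //= e p IH x /and3P[-> _ /IH]. Qed.

(** A demand unit can only leave the center that [A] assigns to it, so distinct sources force
    distinct units. *)
Lemma uniq_moved A p :
  all (transfer_edge A) p -> uniq (sources p) -> uniq (units p).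
Proof.
move=> /allP tp up; apply: (@map_uniq _ _ A); rewrite -map_comp.
by rewrite (@eq_in_map _ _ _ (@source D S) p).1 // => e /tp /andP[/eqP].
Qed.

Lemma simple_path_uniq_sources A x p y :
  simple_path A x p y -> uniq (rcons (sources p) y).
Proof. by case/andP=> w; rewrite (walk_vertices w). Qed.

Lemma simple_path_split A x p y z :
  simple_path A x p y -> z \in x :: targets p ->
  exists p1 p2,
    [/\ p = p1 ++ p2, simple_path A x p1 z & simple_path A z p2 y].
Proof.
case/andP=> w u /(walk_split w)[p1 [p2 [def_p w1 w2]]].
exists p1, p2; split=> //; move: u; rewrite /simple_path def_p map_cat -cat_cons.
  by rewrite cat_uniq w1 => /andP[].
by rewrite w2 -(walk_vertices w1) cat_rcons cat_uniq => /and3P[].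
Qed.

Lemma walk_telescope (V : zmodType) (g : S -> V) A x p y :
  walk A x p y -> \sum_(e <- p) (g (target e) - g (source e)) = g y - g x.
Proof.
elim: p x => [|e p IH] x /=; first by move/eqP->; rewrite big_nil subrr.
by case/and3P=> _ /eqP<- /IH; rewrite big_cons => ->; rewrite addrC addrA subrK.
Qed.

(** * Moving demand units along a list of edges *)

Definition rerouted A B p :=
  [/\ uniq (units p),
      {in p, forall e, A (moved e) = source e /\ B (moved e) = target e}
    & forall d, d \notin units p -> A d = B d].

(** Kept general in [F] to serve both assignment costs and, through the indicator of a center,
    occupancies. *)
Lemma rerouted_sum (V : zmodType) (F : D -> S -> V) A B p : rerouted A B p ->
  \sum_d F d (B d) - \sum_d F d (A d)
  = \sum_(e <- p) (F (moved e) (target e) - F (moved e) (source e)).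
Proof.
case=> up onp offp; rewrite -sumrB.
rewrite (bigID [in units p]) /= addrC big1 ?add0r => [|d /offp->]; last first.
  by rewrite subrr.
rewrite -big_uniq //= big_map; apply: eq_big_seq => e /onp[-> ->] //.
Qed.

Lemma occupancyE A s : (occupancy A s)%:Z = \sum_d (A d == s)%:Z.
Proof.
rewrite /occupancy -sum1dep_card big_mkcond /= -natz natr_sum.
by apply: eq_bigr => d _; case: eqP.
Qed.

(** The indicator of [s] telescopes along the walk. [A0] is independent of [A] because later the
    walk lives in one allotment while the rerouting starts from a reverted one. *)
Lemma rerouted_occupancy A0 A B x p y s : walk A0 x p y -> rerouted A B p ->
  (occupancy B s + (x == s) = occupancy A s + (y == s))%N.
Proof.
move=> w /(rerouted_sum (fun _ t => (t == s)%:Z)); rewrite -!occupancyE.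
rewrite (walk_telescope (fun t => (t == s)%:Z) w) => /eqP.
rewrite subr_eq addrAC eq_sym subr_eq -!PoszD eqz_nat => /eqP <-.
exact: addnC.
Qed.

Lemma rerouted_exists A p :
  all (transfer_edge A) p -> uniq (units p) -> exists B, rerouted A B p.
Proof.
elim: p => [|e p IH] /=; first by exists A.
case/andP=> /andP[/eqP Ae _] /IH{}IH /andP[ep up].
have [B [_ onp offp]] := IH up.
exists [ffun d => if d == moved e then target e else B d].
split=> /= [|e'|d]; first by rewrite ep.
  rewrite inE ffunE => /predU1P[->|e'p]; first by rewrite eqxx.
  have /negPf-> : moved e' != moved e.
    by apply: contraNneq ep => <-; apply: map_f.
  exact: onp.
by rewrite ffunE inE negb_or => /andP[/negPf-> /offp].
Qed.

(** * The multigraph of differences between two allotments *)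

Definition diff_edge A B e := transfer_edge A e && (B (moved e) == target e).

Definition revert A B p : allotment D S :=
  [ffun d => if d \in units p then A d else B d].

Lemma revert_rerouted A B p :
  all (diff_edge A B) p -> uniq (units p) -> rerouted (revert A B p) B p.
Proof.
move=> /allP dp up; split=> // [e ep|d /negPf dp']; last by rewrite ffunE dp'.
rewrite ffunE map_f //.
by have /andP[/andP[/eqP-> _] /eqP->] := dp e ep.
Qed.

Lemma card_revert A B p : p != [::] -> all (diff_edge A B) p ->
  (#|[set d | A d != revert A B p d]| < #|[set d | A d != B d]|)%N.
Proof.
case: p => // e p _ dp; apply: proper_card; apply/properP; split.
  by apply/subsetP=> d; rewrite !inE ffunE; case: ifP => //; rewrite eqxx.
exists (moved e); last by rewrite inE ffunE /= inE !eqxx.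
have /andP[/andP[/andP[/eqP Ae ne] /eqP Be] _] := dp.
by rewrite inE Ae Be eq_sym.
Qed.

Lemma extract_path A B x p y :
    simple_path A x p y -> all (diff_edge A B) p -> p != [::] ->
  exists x' y' q,
    [/\ simple_path A x' q y', all (diff_edge A B) q, x' != y' &
      (exists e, [/\ diff_edge A B e, source e = y' & target e = x'])
      \/ (forall d, B d = x' -> A d = x') /\ (forall d, A d = y' -> B d = y')].
Proof.
have [n] := ubnP (#|S| - size p); elim: n => // n IH in x p y *.
move=> le_n sp dp p0; have /andP[w u] := sp.
(* The vertices of a simple path are distinct and one more than its edges, so each extension lowers
   the measure [#|S| - size p]. *)
have lt_p : (size p < #|S|)%N.
  by have := max_card [in x :: targets p]; rewrite (card_uniqP u) /= size_map.
have next q : size q = (size p).+1 -> (#|S| - size q < n)%N.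
  by move=> ->; rewrite subnS -ltnS prednK // subn_gt0.
case: (boolP [exists d, (A d == y) && (B d != y)]) => [/existsP[d]|noout].
  case/andP=> /eqP Ad Bd; pose e : edge D S := (y, B d, d).
  have de : diff_edge A B e.
    by rewrite /diff_edge /transfer_edge /= Ad Bd !eqxx.
  (* If the new vertex already lies on the path, the final part of [p] from there is closed by [e];
     otherwise [p] grows at its end. *)
  have [Bin|Bout] := boolP (B d \in x :: targets p).
    have [p1 [p2 [def_p _ s2]]] := simple_path_split sp Bin.
    exists (B d), y, p2; split=> //; last by left; exists e.
    by move: dp; rewrite def_p all_cat => /andP[].
  apply: (IH x (rcons p e) (B d)); first by rewrite next ?size_rcons.
  - rewrite /simple_path map_rcons -rcons_cons rcons_uniq Bout u !andbT.
    rewrite -cats1; apply/walk_cat; exists y => //=; rewrite !eqxx !andbT.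
    by case/andP: de.
  - by rewrite all_rcons de.
  - by case: (p).
case: (boolP [exists d, (A d != x) && (B d == x)]) => [/existsP[d]|noin].
  case/andP=> Ad /eqP Bd; pose e : edge D S := (A d, x, d).
  have de : diff_edge A B e.
    by rewrite /diff_edge /transfer_edge /= Bd !eqxx eq_sym Ad.
  (* Symmetrically at the start: either [e] closes the initial part of [p] up to [A d], or [p] grows
     in front. *)
  have [Ain|Aout] := boolP (A d \in x :: targets p).
    have [p1 [p2 [def_p s1 _]]] := simple_path_split sp Ain.
    exists x, (A d), p1; split=> //; last by left; exists e.
      by move: dp; rewrite def_p all_cat => /andP[].
    by rewrite eq_sym.
  apply: (IH (A d) (e :: p) y); first by rewrite next.
  - rewrite /simple_path /= w eqxx (andP de).1 /= in Aout *.
    by rewrite Aout.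
  - by rewrite /= de.
  - by [].
(* Neither end extends, so [p] itself is the open path; its ends differ because it is simple and
   nonempty. *)
exists x, y, p; split=> //.
  have := simple_path_uniq_sources sp; rewrite rcons_uniq => /andP[].
  case: (p) p0 w => //= e p' _ /and3P[_ /eqP-> _].
  by rewrite inE negb_or eq_sym => /andP[].
right; split=> d Ed; apply/eqP.
  by apply: contraNT noin => Ad; apply/existsP; exists d; rewrite Ad Ed eqxx.
by apply: contraNT noout => Bd; apply/existsP; exists d; rewrite Bd Ed eqxx.
Qed.

End Walks.

(** * Cost changes under rerouting *)

Section Costs.

Variables (R : realDomainType) (D S : finType) (I : lbdd R D S).
Implicit Types (A B : allotment D S) (x y z s : S) (p q : seq (edge D S)).

Lemma penalty_mono s : {homo penalty I s : m n / (m <= n)%N >-> m <= n}.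
Proof.
move=> m n le_mn; have [m_le|m_gt] := leqP m (capacity I s).
  rewrite (penalty_eq0 m_le); have [n_le|n_gt] := leqP n (capacity I s).
    by rewrite (penalty_eq0 n_le).
  exact/ltW/penalty_gt0.
exact: penalty_homo.
Qed.

Lemma rerouted_closed_cost A0 A B x p : walk A0 x p x -> rerouted A B p ->
  allotment_cost I B = allotment_cost I A + path_cost I p.
Proof.
move=> w r; rewrite /allotment_cost addrAC; congr (_ + _).
  apply/eqP; rewrite addrC -subr_eq; apply/eqP.
  exact: (rerouted_sum (fun d t => (CM I d t)%:R) r).
apply: eq_bigr => s _.
by have /addIn-> := rerouted_occupancy s w r.
Qed.

Lemma rerouted_open_cost A0 A B x p y :
  x != y -> walk A0 x p y -> rerouted A B p ->
  allotment_cost I B = allotment_cost I A + (path_cost I p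
    + (penalty I y (occupancy A y).+1 - penalty I x (occupancy A x))).
Proof.
move=> nxy w r; rewrite /allotment_cost addrACA; congr (_ + _).
  apply/eqP; rewrite addrC -subr_eq; apply/eqP.
  exact: (rerouted_sum (fun d t => (CM I d t)%:R) r).
have occ s := rerouted_occupancy s w r.
have nyx : y != x by rewrite eq_sym.
apply/eqP; rewrite addrC -subr_eq -sumrB (bigD1 x) // (bigD1 y) //=.
rewrite [X in _ + (_ + X)]big1.
  (* From [A] to [B], [x] loses one unit and [y] gains one: the last penalty of [A] at [x]
     disappears and the next one at [y] appears. *)
  have := occ x; have := occ y.
  rewrite !eqxx (negPf nxy) (negPf nyx) !addn0 !addn1 => -> <-.
  rewrite (big_nat_recr (occupancy B x).+1) //=.
  rewrite (big_nat_recr (occupancy A y).+1) //=.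
  by rewrite addr0 opprD [X in X + _]addrA subrr add0r addrAC subrr add0r addrC.
move=> s /andP[sx sy]; have := occ s.
by rewrite eq_sym (negPf sx) eq_sym (negPf sy) !addn0 => ->; rewrite subrr.
Qed.

(** * Optimality and negative loops *)

Lemma optimal_no_negative_loop A :
  optimal I A -> ~ induces_negative_loop I A.
Proof.
move=> opt [x [y [c [loop]]]]; case: loop => [p e nxy sp te se tg|p nxy sp].
all: have [w _] := andP sp.
all: have us := simple_path_uniq_sources sp.
  have tpe : all (transfer_edge A) (rcons p e).
    by rewrite all_rcons te (walk_transfer w).
  have [|B r] := rerouted_exists tpe.
    (* The closing edge has source [y], the one vertex of the path that is not a source in [p]. *)
    by apply: uniq_moved tpe _; rewrite map_rcons se.
  have wx : walk A x (rcons p e) x.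
    rewrite -cats1; apply/walk_cat; exists y => //=.
    by rewrite te se tg !eqxx.
  have := opt B; rewrite (rerouted_closed_cost wx r) lerDl.
  by rewrite /path_cost -cats1 big_cat big_seq1 /= => /le_gtF->.
have tp := walk_transfer w.
have [|B r] := rerouted_exists tp.
  by apply: uniq_moved tp _; move: us; rewrite rcons_uniq => /andP[].
by have := opt B; rewrite (rerouted_open_cost nxy w r) lerDl => /le_gtF->.
Qed.

Lemma no_negative_loop_optimal A :
  ~ induces_negative_loop I A -> optimal I A.
Proof.
move=> noneg B.
have loop_ge0 x y c : induced_loop I A x y c -> 0 <= c.
  by move=> l; rewrite leNgt; apply/negP=> c0; apply: noneg; exists x, y, c.
have [n] := ubnP #|[set d | A d != B d]|; elim: n => // n IH in B *.
rewrite ltnS => le_n; have [d Ad|same] := pickP (fun d => A d != B d); last first.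
  suff -> : A = B by [].
  by apply/ffunP=> d; apply/eqP; have /negbFE := same d.
pose e : edge D S := (A d, B d, d).
have de : diff_edge A B e by rewrite /diff_edge /transfer_edge /= !eqxx eq_sym Ad.
have se : simple_path A (A d) [:: e] (B d).
  by rewrite /simple_path /= inE !eqxx (andP de).1 Ad.
have [||x [y [p [sp dp nxy ends]]]] := @extract_path _ _ A B _ _ _ se.
- by rewrite /= de.
- by [].
have [w _] := andP sp.
have us := simple_path_uniq_sources sp.
(* The reverted allotment is closer to [A], so the induction hypothesis reduces the goal to
   comparing it with [B]. *)
have revert_le q : q != [::] -> all (diff_edge A B) q ->
    allotment_cost I (revert A B q) <= allotment_cost I B ->
    allotment_cost I A <= allotment_cost I B.
  move=> q0 dq; apply: le_trans; apply: IH.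
  exact: leq_trans (card_revert q0 dq) le_n.
have tq q : all (diff_edge A B) q -> all (transfer_edge A) q.
  by apply: sub_all => e' /andP[].
case: ends => [[e' [de' se' te']]|[noin noout]].
  have dq : all (diff_edge A B) (rcons p e') by rewrite all_rcons de'.
  have uq : uniq (units (rcons p e')).
    by apply: uniq_moved (tq _ dq) _; rewrite map_rcons se'.
  apply: (revert_le _ _ dq); first by case: (p).
  have wx : walk A x (rcons p e') x.
    rewrite -cats1; apply/walk_cat; exists y => //=.
    by rewrite (andP de').1 se' te' !eqxx.
  rewrite (rerouted_closed_cost wx (revert_rerouted dq uq)) lerDl.
  rewrite /path_cost -cats1 big_cat big_seq1 /=.
  by apply: (loop_ge0 x y); apply: TransferLoop; rewrite ?(andP de').1.
have p0 : p != [::] by apply: contraNneq nxy => p0; move: w; rewrite p0.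
have um : uniq (units p).
  by apply: uniq_moved (tq _ dp) _; move: us; rewrite rcons_uniq => /andP[].
have r := revert_rerouted dp um.
apply: (revert_le _ p0 dp).
rewrite (rerouted_open_cost nxy w r) lerDl.
apply: le_trans (loop_ge0 x y _ (PenaltyLoop I nxy sp)) _.
(* Compared with [A], the reverted allotment has no fewer units at [y], by [noout], and no more at
   [x], by [noin]. *)
rewrite lerD2l; apply: lerB; apply: penalty_mono.
  apply/subset_leq_card/subsetP=> d'; rewrite !inE ffunE => /eqP Ad'.
  by case: ifP => _; rewrite ?Ad' ?noout.
apply/subset_leq_card/subsetP=> d'; rewrite !inE ffunE.
by case: ifP => // _ /eqP/noin->.
Qed.

End Costs.

Theorem theorem2 (R : realDomainType) (D S : finType) (I : lbdd R D S)
    (A : allotment D S) :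
  optimal I A <-> ~ induces_negative_loop I A.
Proof.
split; [exact: optimal_no_negative_loop | exact: no_negative_loop_optimal].
Qed.
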